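(* Assume $\diamondsuit^+$. Then for every ladder system $\mathbf C$ on $\omega_1$ there is a special Aronszajn subtree $T\subseteq\sigma'\mathbb Q$ such that every monochromatic $\omega$-colouring of $\mathbf C$ has a $T$-uniformization.
   Context: $\diamondsuit^+$ asserts the existence of $(W_\alpha)_{\alpha<\omega_1}$ with each $W_\alpha$ countable such that for every $X\subseteq\omega_1$ there is a closed unbounded $D\subseteq\omega_1$ with $X\cap\alpha\in W_\alpha$ and $D\cap\alpha\in W_\alpha$ for all $\alpha\in D$. $\sigma\mathbb Q$ is the set of all subsets of $\mathbb Q$ well ordered by the usual order and bounded above in $\mathbb Q$, ordered by end-extension; $\sigma'\mathbb Q$ consists of those with a maximum. A subtree of a tree $U$ of height $\omega_1$ is a downward closed $S\subseteq U$ in which every node has extensions in $S$ of arbitrarily large countable height; $s\upharpoonright\xi$ is the predecessor of $s$ of height $\xi$. A ladder system is $\mathbf C=(C_\alpha)_{\alpha\in\lim(\omega_1)}$ with $C_\alpha$ cofinal in $\alpha$ of order type $\omega$; a monochromatic $\omega$-colouring is $(f_\alpha)$ with each $f_\alpha:C_\alpha\to\omega$ constant. A $T$-uniformization is a map $\varphi$ on a subtree $S$ of $T$ with $\varphi(s\upharpoonright\xi)=f_\alpha(\xi)$ for every $s\in S$ of limit height $\alpha$ and all but finitely many $\xi\in C_\alpha$. An Aronszajn tree is a tree of height $\omega_1$ with countable levels and no uncountable chains; special means a countable union of antichains. *)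

(* Defs.v *)
From HB Require Import structures.
From mathcomp Require Import all_boot all_order all_algebra.
From mathcomp Require Import all_classical.
From mathcomp Require wochoice.

Set Implicit Arguments.
Unset Strict Implicit.
Unset Printing Implicit Defensive.

Import Order.TTheory.
Local Open Scope classical_set_scope.
Local Open Scope order_scope.

Definition least_elements (X : Type) (le : X -> X -> Prop) (A : set X) : Prop :=
  forall B : set X, B `<=` A -> B !=set0 ->
    exists2 m, B m & forall x, B x -> le m x.

Definition order_iso (X Y : Type) (leX : X -> X -> Prop) (A : set X)
    (leY : Y -> Y -> Prop) (B : set Y) : Prop :=
  exists g : X -> Y, set_bij A B g /\
    forall x y, A x -> A y -> (leX x y <-> leY (g x) (g y)).

(* omega_1 is any uncountable well order all of whose proper initial segments
   are countable; this determines it up to a unique isomorphism, and its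
   elements are the countable ordinals. *)
Definition is_omega1 (d : Order.disp_t) (W : orderType d) : Prop :=
  [/\ least_elements (fun x y : W => x <= y) [set: W],
      forall a : W, countable [set x : W | x < a] &
      ~ countable [set: W]].

Section Omega1.
Context (d : Order.disp_t) (W : orderType d).
Implicit Types (a b c : W) (D : set W).

Definition below a : set W := [set x | x < a].

Definition cofinal_in D a : Prop :=
  D `<=` below a /\ forall b, b < a -> exists2 c, D c & b <= c.

(* 0 is not a limit *)
Definition limit a : Prop :=
  below a !=set0 /\ forall b, b < a -> exists2 c, b < c & c < a.

Definition club D : Prop :=
  (forall a, limit a -> cofinal_in (D `&` below a) a -> D a) /\
  (forall b, exists2 c, D c & b < c).

Definition diamond_plus : Prop :=
  exists F : W -> set (set W),
    (forall a, countable (F a)) /\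
    (forall X : set W, exists D : set W, club D /\
      forall a, D a -> F a (X `&` below a) /\ F a (D `&` below a)).

(* Only the values of C and f at limits, and of f a on C a, are meaningful. *)
Definition ladder_system (C : W -> set W) : Prop :=
  forall a, limit a ->
    cofinal_in (C a) a /\
    order_iso (fun x y : W => x <= y) (C a)
              (fun m n : nat => (m <= n)%N) [set: nat].

Definition monochromatic (C : W -> set W) (f : W -> W -> nat) : Prop :=
  forall a, limit a -> forall x y, C a x -> C a y -> f a x = f a y.

(* A tree is a set U of elements of N together with an order le, of which only
   the restriction to U matters. *)
Context (N : choiceType) (le : N -> N -> Prop).
Implicit Types (s t : N) (U S T : set N).

Definition preds U s : set N := [set t | [/\ U t, le t s & t <> s]].

Definition is_tree U : Prop :=
  [/\ forall s, U s -> le s s,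
      forall s t, U s -> U t -> le s t -> le t s -> s = t,
      forall r s t, U r -> U s -> U t -> le r s -> le s t -> le r t &
      forall s, U s -> least_elements le (preds U s)].

Definition has_height U s a : Prop :=
  order_iso le (preds U s) (fun x y : W => x <= y) (below a).

Definition level U a : set N := [set s | U s /\ has_height U s a].

Definition height_omega1 U : Prop :=
  (forall s, U s -> exists a, has_height U s a) /\
  (forall a, level U a !=set0).

(* The empty set is not a subtree. *)
Definition subtree U S : Prop :=
  [/\ S `<=` U,
      S !=set0,
      forall s t, S s -> U t -> le t s -> S t &
      forall s a, S s -> exists t b, [/\ S t, le s t, has_height U t b & a <= b]].

Definition chain U (A : set N) : Prop :=
  A `<=` U /\ forall s t, A s -> A t -> le s t \/ le t s.

Definition antichain U (A : set N) : Prop :=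
  A `<=` U /\ forall s t, A s -> A t -> le s t -> s = t.

Definition aronszajn U : Prop :=
  [/\ is_tree U,
      height_omega1 U,
      forall a, countable (level U a) &
      forall A, chain U A -> countable A].

Definition special U : Prop :=
  exists A : nat -> set N,
    (forall n, antichain U (A n)) /\ U = \bigcup_n A n.

(* The predecessor of s of height x (s itself if there is none). *)
Definition restrict U s (x : W) : N :=
  xget s [set t | [/\ U t, le t s & has_height U t x]].

Definition uniformization (C : W -> set W) (f : W -> W -> nat) T S
    (phi : N -> nat) : Prop :=
  subtree T S /\
  forall s a, S s -> limit a -> has_height T s a ->
    finite_set [set x | C a x /\ phi (restrict T s x) <> f a x].

End Omega1.

Definition end_extends (A B : set rat) : Prop :=
  A `<=` B /\ forall x y, A x -> (B `\` A) y -> x < y.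

Definition sigmaQ : set (set rat) :=
  [set A | least_elements (fun x y : rat => x <= y) A /\
           exists q : rat, forall x, A x -> x <= q].

(* The nodes of sigma'Q below A are the sets {x in A | x <= q} with q in A not
   maximal, so a set of order type a + 1 has height a; the empty set is not a
   node. *)
Definition sigmaQ' : set (set rat) :=
  [set A | sigmaQ A /\ exists2 q : rat, A q & forall x, A x -> x <= q].

(* The hypothesis that W is omega_1 is satisfiable. *)
Lemma omega1_exists : exists (d : Order.disp_t) (W : orderType d), is_omega1 W.
Proof.
have [T ncT] : exists T : choiceType, ~ countable [set: T].
  exists (set nat) => /countable_injP[f finj].
  pose Dg := [set n | exists2 A, f A = n & ~ A n].
  have nD : ~ Dg (f Dg).
    move=> [A fA nA]; have AD : A = Dg by apply: finj; rewrite ?inE.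
    by apply: (nA); rewrite AD; exists A.
  by apply: (nD); exists Dg.
have [R woR] := wochoice.well_ordering_principle T.
have minR (A : set T) : A !=set0 -> exists2 m, A m & forall x, A x -> R m x.
  move=> [a Aa].
  have [|m [[Am lbm] _]] := woR [pred x | `[< A x >]].
    by exists a; apply/asboolP.
  exists m; first exact/asboolP.
  by move=> x Ax; apply: lbm; apply/asboolP.
have totR : total R.
  move=> x y; have [|m [->|->] Hm] := minR [set z | z = x \/ z = y].
  - by exists x; left.
  - by rewrite Hm//; right.
  - by rewrite (Hm x) ?orbT//; left.
have reflR : reflexive R by move=> x; have := totR x x; rewrite orbb.
have antiR : antisymmetric R.
  have RT : wochoice.wo_chain R predT by move=> A _; exact: woR.
  by move=> x y; apply: (wochoice.wo_chain_antisymmetric RT).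
have transR : transitive R.
  move=> y x z Rxy Ryz.
  have [|m [->|[->|->]] Hm] := minR [set w | w = x \/ w = y \/ w = z].
  - by exists x; left.
  - by apply: Hm; right; right.
  - have Ryx : R y x by apply: Hm; left.
    by rewrite (antiR x y) // Rxy Ryx.
  - have Rzy : R z y by apply: Hm; right; left.
    by rewrite -(antiR y z) // Ryz Rzy.
pose P (x : T) := `[< countable [set y | R y x /\ y <> x] >].
pose I := {x : T | P x}.
pose leI (x y : I) := R (val x) (val y).
have leI_refl : reflexive leI by move=> x; exact: reflR.
have leI_anti : antisymmetric leI by move=> x y /antiR /val_inj.
have leI_trans : transitive leI by move=> y x z; exact: transR.
have leI_total : total leI by move=> x y; exact: totR.
pose W0 : porderType (Order.Disp tt tt) := HB.pack I
  (@Order.Le_isPOrder.Build (Order.Disp tt tt) I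
     leI leI_refl leI_anti leI_trans).
pose W : orderType (Order.Disp tt tt) :=
  HB.pack I W0 (@Order.POrder_isTotal.Build _ W0 leI_total).
exists (Order.Disp tt tt), W; split.
- move=> B _ [b Bb].
  have [|_ [m Bm <-] Hm] := minR ((val : I -> T) @` (B : set I)).
    by exists (sval b); exists b.
  by exists m => // x Bx; apply: Hm; exists x.
- move=> a; have /asboolP := svalP (a : I).
  apply: sub_countable.
  rewrite -(card_le_eql (@inj_card_eq _ _ [set x : W | x < a] (val : I -> T) _)).
    apply: subset_card_le => _ [x xa <-]; split; first exact: (ltW xa : R _ _).
    by move=> /val_inj xa'; move: xa; rewrite /= xa' ltxx.
  by move=> ? ? _ _; exact: val_inj.
- move=> cW.
  have cP : countable [set x | P x].
    rewrite (_ : [set x | P x] = (val : I -> T) @` [set: I]).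
      exact: card_le_trans (card_image_le _ _) cW.
    apply/seteqP; split=> [x Px|_ [x _ <-]]; first by exists (exist _ x Px).
    exact: svalP.
  have [[x nPx]|allP] := pselect (exists x, ~ P x).
    have [|m nPm Hm] := minR [set x | ~ P x]; first by exists x.
    apply: nPm; apply/asboolP; apply: sub_countable cP.
    apply: subset_card_le => y [Rym nym] /=; apply: contrapT => nPy.
    by apply: nym; apply: antiR; rewrite Rym Hm.
  apply: ncT; apply: sub_countable cP; apply: subset_card_le => x _ /=.
  by apply: contrapT => nPx; apply: allP; exists x.
Qed.

(* Main.v *)
(* The levels of [T] are built by recursion. A node of height [a] is a set of
   rationals of order type [a + 1], and every node whose elements are below a
   rational [r] gets extensions below [r] of every larger height. Let [h] give
   the constant values of a colouring and let [D] be a club on which [h] and [D]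
   are guessed.

   Each interval [[m, n)] between successive points of [D] is countable, so the
   ladders of the limits in [(m, n]] are disjoint up to finite sets and [h] is
   uniformized there by a function of the height alone. The element of a node at
   position [m] codes a pair [(i, k)], and the colour of the node is changed to
   [i] at the first [k] heights of the interval in some enumeration; since every
   code is dense in the rationals, any finite part of the interval can be given
   any constant colour. Only the limits [a] of [D] remain. [S] consists of the
   nodes that obey [h] at all of these. If [h] and [D] are known below [a], then
   so are the colouring and [S]; every node of [S] below [a] has, for each
   possible value [h a], a branch of length [a] through [S] that has this colour
   at almost all points of the ladder at [a], because that ladder meets every
   interval of [D] in a finite set. So it suffices to put such branches in level
   [a] of [T] for each of the countably many guesses at [a].

   [T] is special because end-extension strictly increases the maximum. *)

Require Import Defs.
From HB Require Import structures.
From mathcomp Require Import all_boot all_order all_algebra.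
From mathcomp Require Import all_classical.
From mathcomp Require Import archimedean ring lra.

Set Implicit Arguments.
Unset Strict Implicit.
Unset Printing Implicit Defensive.

Import Order.TTheory GRing.Theory Num.Theory.
Local Open Scope classical_set_scope.
Local Open Scope order_scope.

(** * A map from the rationals to pairs of naturals with dense fibres *)

Definition twoadic_code (q : rat) : nat * nat :=
  odflt (0, 0)%N (unpickle (logn 2 `|denq q|)).

(* Fractions with denominator [2 ^ m * 3 ^ l] and numerator [1] modulo [6] are
   reduced, and they are dense when [m] is fixed and [l] grows. *)
Lemma twoadic_code_dense (p : nat * nat) (r s : rat) :
  r < s -> exists2 q, r < q < s & twoadic_code q = p.
Proof.
move=> rs; set m := pickle p.
(* Admissible numerators are [6] apart, so the mesh [6 / N] has to be smaller than [s - r]. *)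
have [l hl] : exists l, (6%:R / (s - r) < (2 ^ m * 3 ^ l)%:R)%R.
  exists (Num.Def.archi_bound (6%:R / (s - r)))%R.
  apply: lt_le_trans (archi_boundP _) _.
    by rewrite divr_ge0 // subr_ge0 ltW.
  rewrite ler_nat; set b := Num.Def.archi_bound _.
  apply: (@leq_trans (3 ^ b)%N); first by apply: ltnW; apply: ltn_expl.
  by rewrite leq_pmull // expn_gt0.
set N := (2 ^ m * 3 ^ l)%N in hl.
have N0 : (0 < N)%N by rewrite muln_gt0 !expn_gt0.
have NR0 : (0 < N%:R :> rat)%R by rewrite ltr0n.
have hN : (6%:R < (s - r) * N%:R)%R.
  by rewrite mulrC -ltr_pdivrMr ?subr_gt0.
(* [b] is the least integer with [r < (6 * b + 1) / N]; hence [6 * b + 1 <= r * N + 6 < s * N]. *)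
pose x := ((r * N%:R - 1) / 6%:R)%R; pose b := (Num.floor x + 1)%R.
have xb : (x < b%:~R)%R by exact: real_floorD1_gt (num_real x).
have bx : (b%:~R <= x + 1)%R by rewrite rmorphD /= lerD2r real_floor_le ?num_real.
pose a := (6%:R * b + 1)%R : int.
have aE : (a%:~R = 6%:R * b%:~R + 1 :> rat)%R.
  by rewrite rmorphD rmorphM /= rmorph_nat.
exists (a%:~R / N%:R)%R.
  rewrite ltr_pdivlMr // ltr_pdivrMr // aE.
  move: xb bx; rewrite /x ltr_pdivrMr // -lerBlDr ler_pdivlMr // => h1 h2.
  by apply/andP; split; lra.
have aN : coprime `|a| N.
  have a2 : coprime `|a| 2.
    by rewrite -[2%N]/`|Posz 2|%N -coprimezE; apply/coprimezP;
      exists (1, - 3%:R * b)%R; rewrite /= /a; ring.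
  have a3 : coprime `|a| 3.
    by rewrite -[3%N]/`|Posz 3|%N -coprimezE; apply/coprimezP;
      exists (1, - 2%:R * b)%R; rewrite /= /a; ring.
  by rewrite coprimeMr !coprimeXr.
have -> : (N%:R = (Posz N)%:~R :> rat)%R by [].
rewrite /twoadic_code coprimeq_den // eqz_nat -[_ == 0%N]negbK -lt0n N0 /=.
by rewrite lognM ?expn_gt0 // lognX lognX (@logn_prime 2 3) //
  logn_prime // muln1 muln0 addn0 pickleK.
Qed.

(** * Finite and countable sets *)

Lemma finite_set_inj_bounded (T : Type) (A : set T) (g : T -> nat) (k : nat) :
  (forall x y, A x -> A y -> g x = g y -> x = y) ->
  (forall x, A x -> (g x < k)%N) -> finite_set A.
Proof.
move=> ginj gk.
have eqA : (g @` A #= A)%card.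
  by apply: inj_card_eq => x y; rewrite !inE; exact: ginj.
rewrite -(eq_finite_set eqA).
by apply: sub_finite_set (finite_II k) => _ [x Ax <-]; exact: gk.
Qed.

Lemma countable_setU (T : Type) (A B : set T) :
  countable A -> countable B -> countable (setU A B).
Proof.
move=> cA cB; rewrite -bigcup2E; apply: bigcup_countable; first exact: countableP.
by move=> [|[|i]] _ //=; exact: countable0.
Qed.

Lemma countable_subset (T : Type) (A B : set T) :
  A `<=` B -> countable B -> countable A.
Proof. by move=> /subset_card_le; exact: sub_countable. Qed.

Lemma countable_image (T U : Type) (f : T -> U) (A : set T) :
  countable A -> countable (f @` A).
Proof. exact: card_le_trans (card_image_le _ _). Qed.

(** * Successors, limits and ladders in omega_1 *)

Section Omega1Theory.
Context (d : Order.disp_t) (W : orderType d) (hW : is_omega1 W).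
Implicit Types (a b c x y : W).

Lemma ex_least (P : set W) : P !=set0 -> exists2 m, P m & forall x, P x -> m <= x.
Proof. by case: hW => wo _ _; apply: wo => x. Qed.

Lemma omega1_ind (P : W -> Prop) :
  (forall a, (forall b, b < a -> P b) -> P a) -> forall a, P a.
Proof.
move=> IH a; apply: contrapT => nPa.
have [|m nPm mle] := @ex_least [set x | ~ P x]; first by exists a.
apply: nPm; apply: IH => b bm; apply: contrapT => nPb.
by have := mle b nPb; rewrite leNgt bm.
Qed.

Lemma omega1_wf : well_founded (fun a b : W => a < b).
Proof. by move=> a; elim/omega1_ind: a => a IH; constructor. Qed.

(** The argument is only a default for [xget]; by [wzero_eq] the value does not depend on it. *)
Definition wzero (x : W) := xget x [set z | forall y, z <= y].
Definition wsucc a := xget a [set b | a < b /\ forall x, a < x -> b <= x].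

Lemma wzero_le x y : wzero x <= y.
Proof.
have [|m _ mle] := @ex_least [set: W]; first by exists x.
by apply: (@xgetI _ x [set z | forall y, z <= y] m) => z; apply: mle.
Qed.

Lemma wzero_eq x y : wzero x = wzero y.
Proof. by apply/le_anti; rewrite !wzero_le. Qed.

Lemma countable_le a : countable [set x : W | x <= a].
Proof.
have [_ cW _] := hW.
apply: countable_subset (countable_setU (cW a) (countable1 a)) => x /=.
by rewrite le_eqVlt => /orP[/eqP|]; [right|left].
Qed.

(** A largest element would make [W] countable. *)
Lemma wsuccP a : a < wsucc a /\ forall x, a < x -> wsucc a <= x.
Proof.
have [|m am mle] := @ex_least [set x | a < x].
  apply: contrapT => nex; case: hW => _ _; apply.
  apply: countable_subset (countable_le a) => x _ /=.
  by rewrite leNgt; apply/negP => ax; apply: nex; exists x.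
exact: (@xgetI _ a [set b | a < b /\ forall x, a < x -> b <= x] m).
Qed.

Lemma ltwS a : a < wsucc a. Proof. by have [] := wsuccP a. Qed.

Lemma leSw a x : (wsucc a <= x) = (a < x).
Proof.
by apply/idP/idP => [|/(wsuccP a).2//]; apply: lt_le_trans; exact: ltwS.
Qed.

Lemma ltSw a x : (x < wsucc a) = (x <= a).
Proof. by rewrite ltNge leSw -leNgt. Qed.

Lemma leSS a b : (wsucc a <= wsucc b) = (a <= b).
Proof. by rewrite leSw ltSw. Qed.

Lemma wsucc_inj : injective wsucc.
Proof. by move=> a b ab; apply/le_anti/andP; split; rewrite -leSS ab. Qed.

Lemma limit_wsucc a b : limit a -> b < a -> wsucc b < a.
Proof. by move=> [_ la] /la[c bc]; apply: le_lt_trans; rewrite leSw. Qed.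

Lemma not_limit_wsucc b : ~ limit (wsucc b).
Proof. by move=> /limit_wsucc /(_ (ltwS b)); rewrite ltxx. Qed.

Lemma limit_iter_wsucc a b n : limit a -> b < a -> iter n wsucc b < a.
Proof. by move=> la ba; elim: n => //= n; exact: limit_wsucc. Qed.

(** Peeling off successors on both sides reaches the two limits together, because no successor is a
    limit. This makes [encode] decodable. *)
Lemma limit_iter_inj a b m n : limit a -> limit b ->
  iter m wsucc a = iter n wsucc b -> m = n.
Proof.
move=> la lb; elim: m n => [|m IH] [|n] //=.
- by move=> E; rewrite E in la; case: (not_limit_wsucc la).
- by move=> E; rewrite -E in lb; case: (not_limit_wsucc lb).
- by move=> /wsucc_inj /IH ->.
Qed.

Lemma omega1_cases a :
  [\/ forall x, ~ x < a, exists b, a = wsucc b | limit a].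
Proof.
have [a0|/existsNP[z /contrapT za]] := pselect (forall x, ~ x < a).
  by constructor 1.
have [la|nla] := pselect (forall b, b < a -> exists2 c, b < c & c < a).
  by constructor 3; split => //; exists z.
constructor 2; have /existsNP[b /not_implyP[ba nb]] := nla; exists b.
apply/le_anti; rewrite leSw ba andbT leNgt; apply/negP => ab; apply: nb.
by exists (wsucc b) => //; exact: ltwS.
Qed.

(** These enumerations rank the ladders in [owner] and delimit the overridden heights in
    [colour]. *)
Lemma ex_segment_injections :
  exists e : W -> W -> nat, forall a x y,
    x <= a -> y <= a -> e a x = e a y -> x = y.
Proof.
suff /choice[e eP] : forall a, exists f : W -> nat, forall x y,
    x <= a -> y <= a -> f x = f y -> x = y by exists e.
move=> a; have /countable_injP[f finj] := countable_le a.
by exists f => x y xa ya; apply: finj; rewrite inE.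
Qed.

Section Ladder.
Context (C : W -> set W) (hC : ladder_system C).

Lemma ladder_below a x : limit a -> C a x -> x < a.
Proof. by move=> /hC[[sC _] _] /sC. Qed.

Lemma ladder_index a : limit a -> exists g : W -> nat,
  [/\ forall x y, C a x -> C a y -> (x < y) = (g x < g y)%N,
      forall x y, C a x -> C a y -> g x = g y -> x = y &
      forall n, exists2 x, C a x & g x = n].
Proof.
move=> /hC[_ [g [[_ ginj gsurj] gmono]]]; exists g; split.
- move=> x y Cx Cy; rewrite ltNge ltnNge; congr (~~ _).
  by apply/idP/idP => /(gmono _ _ Cy Cx).
- by move=> x y Cx Cy; apply: ginj; rewrite inE.
- by move=> n; have [x Cx xn] := gsurj n I; exists x.
Qed.

Lemma ladder_finite_below a b : limit a -> b < a ->
  finite_set [set x | C a x /\ x < b].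
Proof.
move=> la ba; have [g [gmono ginj gsurj]] := ladder_index la.
have [[_ /(_ b ba)[c Cc bc]] _] := hC la.
apply: (@finite_set_inj_bounded _ _ g (g c)).
  by move=> x y [Cx _] [Cy _]; exact: ginj.
by move=> x [Cx xb]; rewrite -gmono //; exact: lt_le_trans bc.
Qed.

(** The ladder of the smaller limit lies below that limit, where the other ladder has only finitely
    many points. *)
Lemma ladder_almost_disjoint a b : limit a -> limit b -> a <> b ->
  finite_set (C a `&` C b).
Proof.
wlog ab : a b / a < b => [hwlog|] la lb nab.
  have [/hwlog|/hwlog|//] := ltgtP a b; first exact.
  by rewrite setIC; apply => // /esym.
apply: sub_finite_set (ladder_finite_below lb ab) => x [Cax Cbx]; split => //.
exact: ladder_below Cax.
Qed.

End Ladder.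
End Omega1Theory.

(** * Levels of increasing sequences of rationals, built by recursion *)

Section Levels.
Context (d : Order.disp_t) (W : orderType d) (hW : is_omega1 W).
Implicit Types (a b c x y : W) (u v s : W -> rat) (q r : rat).
Implicit Types (L : W -> set (W -> rat)) (Q : set (W -> rat)).

Definition agree a u v := forall x, x < a -> u x = v x.

Definition trunc u b : W -> rat := fun x => if x < b then u x else 0%R.

Definition set_at u b q : W -> rat := fun x => if x == b then q else u x.

(** The gap between [r'] and [r] leaves room for further elements below [r]. *)
Definition bounded_below a u r := exists2 r', r' < r & forall x, x < a -> u x <= r'.

(* A well-ordered set of rationals of order type [a] is represented by its
   increasing enumeration, set to [0] from [a] on. *)
Definition branch a L u :=
  [/\ forall x, a <= x -> u x = 0%R,
      forall x y, x < y -> y < a -> u x < u y,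
      exists r, forall x, x < a -> u x <= r &
      forall b, b < a -> L b (trunc u b)].

Definition branch_through a L b s q Q : set (W -> rat) :=
  [set u | [/\ branch a L u, agree b s u, forall x, x < a -> u x <= q & Q u]].

Context (Qf : W -> set (set (W -> rat))).

(* [Qf a] is the family of requirements to be met at the limit level [a]: one
   branch is kept for each requirement, each node below [a] and each rational. *)
Definition lev_step a L : set (W -> rat) :=
  [set u | branch a L u /\ (limit a -> exists b s q Q,
     [/\ b < a, L b s, Qf a Q & u = xget (fun=> 0%R) (branch_through a L b s q Q)])].

(** The recursive call at [a] is padded with empty levels from [a] on; [lev_step_ext] shows that
    only the levels below [a] matter. *)
Definition lev : W -> set (W -> rat) :=
  Fix (omega1_wf hW) (fun=> set (W -> rat))
    (fun a rec => lev_step a (fun b u => exists ba : b < a, rec b ba u)).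

Lemma branch_ext a L L' : (forall b, b < a -> L b = L' b) ->
  branch a L = branch a L'.
Proof.
move=> LL'; apply/funext => u; apply/propext.
by split => -[h1 h2 h3 h4]; split => // b ba; have := h4 b ba; rewrite LL'.
Qed.

Lemma lev_step_ext a L L' : (forall b, b < a -> L b = L' b) ->
  lev_step a L = lev_step a L'.
Proof.
move=> LL'; have bLL' := branch_ext LL'.
have tLL' b s q Q : branch_through a L b s q Q = branch_through a L' b s q Q.
  by rewrite /branch_through bLL'.
apply/funext => u; apply/propext; rewrite /lev_step /= bLL'.
split => -[bu h]; split => // /h[b [s [q [Q [ba Ls QQ ->]]]]];
  exists b, s, q, Q; split => //; rewrite ?tLL' //.
  by rewrite -LL'.
by rewrite LL'.
Qed.

Lemma levE a : lev a = lev_step a lev.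
Proof.
rewrite {1}/lev Fix_eq.
  apply: lev_step_ext => b ba; apply/funext => u; apply/propext.
  by split => [[]|h]; last exists ba.
move=> x f g fg; apply: lev_step_ext => b bx; apply/funext => u; apply/propext.
by split => -[h hu]; exists h; move: hu; rewrite fg.
Qed.

Lemma lev_branch a u : lev a u -> branch a lev u.
Proof. by rewrite levE => -[]. Qed.

Lemma trunc_agree u b : agree b u (trunc u b).
Proof. by move=> x xb; rewrite /trunc xb. Qed.

Lemma agree_trans a b u v s : b <= a -> agree b u v -> agree a v s -> agree b u s.
Proof. by move=> ba uv vs x xb; rewrite uv // vs //; exact: lt_le_trans ba. Qed.

Lemma agree_le a b u v : b <= a -> agree a u v -> agree b u v.
Proof. by move=> ba uv x xb; rewrite uv //; exact: lt_le_trans ba. Qed.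

Lemma eq_trunc a u v : agree a u v -> trunc u a = trunc v a.
Proof. by move=> uv; apply/funext => x; rewrite /trunc; case: ifP => // /uv. Qed.

Lemma lev_trunc_id a u : lev a u -> trunc u a = u.
Proof.
move=> /lev_branch[u0 _ _ _]; apply/funext => x; rewrite /trunc.
by case: ltP => // /u0.
Qed.

Lemma lev_trunc a b u : lev a u -> b <= a -> lev b (trunc u b).
Proof.
move=> au; rewrite le_eqVlt => /orP[/eqP->|ba]; first by rewrite lev_trunc_id.
by have [_ _ _] := lev_branch au; apply.
Qed.

Lemma lev_incr a u x y : lev a u -> x < y -> y < a -> u x < u y.
Proof. by move=> /lev_branch[_ h _ _]; exact: h. Qed.

Lemma lev_bounded a u : lev a u -> exists r, bounded_below a u r.
Proof.
move=> /lev_branch[_ _ [r ur] _]; exists (r + 1)%R, r => //.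
by rewrite ltrDl.
Qed.

Lemma bounded_between a u r : bounded_below a u r ->
  exists2 r', r' < r & bounded_below a u r'.
Proof.
move=> [r1 r1r ur1]; exists ((r1 + r) / 2)%R; first lra.
by exists r1 => //; lra.
Qed.

Lemma lev_zero a : (forall x, ~ x < a) -> lev a (fun=> 0%R).
Proof.
move=> a0; rewrite levE; split; last by move=> [[x /a0]].
by split => // [x y _ /a0//|| b /a0//]; exists 0%R => x /a0.
Qed.

Lemma set_at_agree u b q : agree b u (set_at u b q).
Proof. by move=> x xb; rewrite /set_at lt_eqF. Qed.

(** Branches are selected only at limits, so a successor level admits every one-point extension. *)
Lemma lev_wsucc b v q : lev b v -> (forall x, x < b -> v x < q) ->
  lev (wsucc b) (set_at v b q).
Proof.
move=> bv vq; rewrite levE; split; last by move=> /(not_limit_wsucc hW).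
have [v0 vi _ _] := lev_branch bv; split.
- move=> x; rewrite leSw // => bx; rewrite /set_at gt_eqF // v0 //.
  exact: ltW.
- move=> x y xy; rewrite ltSw // le_eqVlt => /orP[/eqP yb|yb].
    by rewrite /set_at yb eqxx -yb lt_eqF // vq // -yb.
  by rewrite -!set_at_agree ?vi //; exact: lt_trans yb.
- exists q => x; rewrite ltSw // le_eqVlt => /orP[/eqP->|xb].
    by rewrite /set_at eqxx.
  by rewrite -set_at_agree // ltW // vq.
- move=> c; rewrite ltSw // => cb.
  rewrite -(@eq_trunc c v); first exact: lev_trunc bv cb.
  exact: agree_le cb (@set_at_agree v b q).
Qed.

(** A satisfiable requirement is met by the branch that [xget] selects, which need not be the one
    that witnesses satisfiability. *)
Lemma lev_limit a b s q Q : limit a -> b < a -> lev b s -> Qf a Q ->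
  branch_through a lev b s q Q !=set0 ->
  exists u, lev a u /\ branch_through a lev b s q Q u.
Proof.
move=> la ba bs QQ /(xgetPex (fun=> 0%R)) hu.
exists (xget (fun=> 0%R) (branch_through a lev b s q Q)); split => //.
by rewrite {1}levE; split; [case: hu | exists b, s, q, Q].
Qed.

(** A node of successor level is determined by a lower node and a rational, one of limit level by
    the data [(b, s, q, Q)] for which it was selected. *)
Lemma countable_lev : (forall a, countable (Qf a)) -> forall a, countable (lev a).
Proof.
move=> cQ; apply: (omega1_ind hW) => a IH.
have cbelow c : countable [set x : W | x < c] by case: hW.
have [a0|[b ab]|la] := omega1_cases hW a.
- apply: countable_subset (countable1 (fun=> 0%R : rat)) => u au.
  have [u0 _ _ _] := lev_branch au; apply/funext => x; apply: u0.
  by rewrite leNgt; apply/negP => /a0.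
- have ba : b < a by rewrite ab ltwS.
  apply: countable_subset
    (countable_image (fun p => set_at p.1 b p.2)
       (countableX (IH b ba) (countableP [set: rat]))) => u au.
  exists (trunc u b, u b); first by split => //; apply: lev_trunc au (ltW ba).
  have [u0 _ _ _] := lev_branch au.
  apply/funext => x; rewrite /set_at /trunc /=.
  case: ltgtP => [//|bx|->//]; rewrite u0 // ab leSw //.
- have cU : countable (\bigcup_(b in below a) lev b).
    by apply: bigcup_countable => [|b]; [exact: cbelow | exact: IH].
  apply: countable_subset
    (countable_image
       (fun p => xget (fun=> 0%R) (branch_through a lev p.1.1.1 p.1.1.2 p.1.2 p.2))
       (countableX (countableX (countableX (cbelow a) cU)
          (countableP [set: rat])) (cQ a))) => u.
  rewrite levE => -[_ /(_ la)[b [s [q [Q [ba bs QQ ->]]]]]].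
  by exists (b, s, q, Q) => //; do ![split => //]; exists b.
Qed.

(* Dependent choice along cofinally many levels below [a]. *)
Lemma branch_of_steps a b s r (Inv : nat -> W -> (W -> rat) -> Prop) :
  Inv 0%N b s ->
  (forall i c u, Inv i c u -> lev c u /\ forall x, x < c -> u x <= r) ->
  (forall i c u, Inv i c u ->
     exists c' u', [/\ c <= c', agree c u u' & Inv i.+1 c' u']) ->
  (forall x, x < a -> exists i, forall c u, Inv i c u -> x < c) ->
  exists v, [/\ branch a lev v, agree (Order.min a b) s v,
    forall x, x < a -> v x <= r &
    forall x, x < a -> exists i c u,
      [/\ Inv i c u, x < c & agree (Order.min a c) u v]].
Proof.
move=> Inv0 Invlev Invstep Invcof.
pose R (p p' : nat * (W * (W -> rat))) := Inv p.1 p.2.1 p.2.2 ->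
  [/\ p'.1 = p.1.+1, p.2.1 <= p'.2.1, agree p.2.1 p.2.2 p'.2.2 &
      Inv p'.1 p'.2.1 p'.2.2].
have /choice[F FP] : forall p, exists p', R p p'.
  move=> p; have [h|h] := pselect (Inv p.1 p.2.1 p.2.2); last by exists p => /h.
  by have [c [u [pc pu ih]]] := Invstep _ _ _ h; exists (p.1.+1, (c, u)).
pose G i := iter i F (0%N, (b, s)).
have GI i : (G i).1 = i /\ Inv i (G i).2.1 (G i).2.2.
  elim: i => [//|i [Gi IH]].
  have := FP (G i); rewrite /R Gi => /(_ IH) /=.
  by rewrite -/(G i.+1) => -[-> _ _].
have Gstep i : (G i).2.1 <= (G i.+1).2.1 /\ agree (G i).2.1 (G i).2.2 (G i.+1).2.2.
  have [Gi IH] := GI i.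
  by have := FP (G i); rewrite /R Gi => /(_ IH) /= [].
have Gle i j : (i <= j)%N ->
    (G i).2.1 <= (G j).2.1 /\ agree (G i).2.1 (G i).2.2 (G j).2.2.
  move=> /subnKC <-; elim: (j - i)%N => [|k [IH1 IH2]]; first by rewrite addn0.
  rewrite addnS; have [h1 h2] := Gstep (i + k)%N; split.
    exact: le_trans h1.
  exact: agree_trans h2.
have Gagree i j x : x < (G i).2.1 -> x < (G j).2.1 -> (G i).2.2 x = (G j).2.2 x.
  by move=> xi xj; have [/Gle[_ ->]|/ltnW /Gle[_ ->]] := leqP i j.
pose idx x := xget 0%N [set i | x < (G i).2.1].
have idxP x : x < a -> x < (G (idx x)).2.1.
  move=> /Invcof[i hi].
  apply: (@xgetI _ 0%N [set i | x < (G i).2.1] i).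
  by apply: hi; have [_] := GI i; exact.
(* The steps may reach beyond [a], so their union is cut off there; hence the minima in the
   conclusion. *)
pose v x := if x < a then (G (idx x)).2.2 x else 0%R.
have vG i x : x < a -> x < (G i).2.1 -> v x = (G i).2.2 x.
  by move=> xa xi; rewrite /v xa; apply: Gagree => //; exact: idxP.
have levG i : lev (G i).2.1 (G i).2.2 by have [_ /Invlev[]] := GI i.
have vr x : x < a -> v x <= r.
  move=> xa; rewrite (vG (idx x)) //; last exact: idxP.
  by have [_ /Invlev[_]] := GI (idx x); apply; exact: idxP.
exists v; split => //.
- split; last 2 first.
  + by exists r.
  + move=> c ca; have ci := idxP c ca.
    rewrite (@eq_trunc c _ (G (idx c)).2.2).
      exact: lev_trunc (levG _) (ltW ci).
    by move=> x xc; apply: vG; exact: lt_trans xc _.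
  + by move=> x; rewrite /v ltNge => ->.
  + move=> x y xy ya; have yi := idxP y ya.
    rewrite (vG (idx y)) ?(lt_trans xy) // (vG (idx y)) //.
    exact: lev_incr xy yi.
- by move=> x; rewrite lt_min => /andP[xa xb]; rewrite (vG 0%N).
- move=> x xa; exists (idx x), (G (idx x)).2.1, (G (idx x)).2.2; split.
  + by have [_] := GI (idx x).
  + exact: idxP.
  + by move=> y; rewrite lt_min => /andP[ya yi]; rewrite (vG (idx x)).
Qed.

End Levels.

Lemma finite_set_bounded (T : eqType) (A : set T) (f : T -> nat) :
  finite_set A -> exists k, forall x, A x -> (f x < k)%N.
Proof.
move=> /finite_seqP[s ->]; elim: s => [|y s [k IH]]; first by exists 0%N.
exists (maxn (f y).+1 k) => x /=; rewrite in_cons leq_max => /orP[/eqP->|/IH->].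
  by rewrite leqnn.
by rewrite orbT.
Qed.

(** * The colour of a node and its coherence with a colouring of the ladders *)

Section Colouring.
Context (d : Order.disp_t) (W : orderType d) (hW : is_omega1 W).
Context (C : W -> set W) (hC : ladder_system C).
Context (e : W -> W -> nat).
Context (e_inj : forall a x y, x <= a -> y <= a -> e a x = e a y -> x = y).
Implicit Types (a b c x y : W) (u v s : W -> rat) (q r : rat) (D : set W).
Implicit Types (h : W -> nat).

(** With zero as default, [prv D] is constant also on the heights before the first point of [D]. *)
Definition prv D x : W :=
  xget (wzero x) [set m | [/\ D m, m <= x & forall y, D y -> y <= x -> y <= m]].

Definition nxt D x : W :=
  xget x [set m | [/\ D m, x < m & forall y, D y -> x < y -> m <= y]].

(* The ladders of the countably many limits up to [b] become disjoint after
   removing finitely many points of each: a point is attributed to the first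
   ladder containing it, in the enumeration [e b]. *)
Definition owner b x : W :=
  xget x [set a | [/\ limit a, a <= b, C a x &
    forall a', limit a' -> a' <= b -> C a' x -> (e b a <= e b a')%N]].

(* Between two successive points of [D] the colour is that of the owning ladder,
   overridden on the finite set [e _ x < k] by the constant [n], where [(n, k)]
   is read off the element of the node at the beginning of the interval. *)
Definition colour h D u x : nat :=
  let p := twoadic_code (u (prv D x)) in
  if (e (nxt D x) x < p.2)%N then p.1 else h (owner (nxt D x) x).

Definition limit_of D a : Prop :=
  below a !=set0 /\ forall b, b < a -> exists c, [/\ D c, b < c & c < a].

(** Only limit points of [D] are constrained; [coherent_uniformizes] takes care of the other
    limits. *)
Definition coherent h D a u : Prop := forall c, c <= a -> limit_of D c ->
  finite_set [set x | C c x /\ colour h D u x <> h c].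

Lemma limit_of_limit D a : limit_of D a -> limit a.
Proof. by move=> [a0 h]; split => // b /h[c [_ bc ca]]; exists c. Qed.

Lemma not_limit_of D a : limit a -> ~ limit_of D a ->
  exists2 b, b < a & forall c, D c -> b < c -> a <= c.
Proof.
move=> la nDa; apply: contrapT => nex; apply: nDa; split; first by case: la.
move=> b ba; apply: contrapT => nc; apply: nex; exists b => // c Dc bc.
by rewrite leNgt; apply/negP => ca; apply: nc; exists c.
Qed.

Lemma limit_of_club D a : club D -> limit_of D a -> D a.
Proof.
move=> [cl _] Da; have la := limit_of_limit Da; apply: cl => //; split.
  by move=> x [].
by move=> b /Da.2[c [Dc bc ca]]; exists c => //; exact: ltW.
Qed.

Lemma prv_le D x : prv D x <= x.
Proof. by rewrite /prv; case: xgetP => [m _ []//|_]; exact: wzero_le. Qed.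

Lemma prv_eq D x m : D m -> m <= x -> (forall y, D y -> y <= x -> y <= m) ->
  prv D x = m.
Proof.
move=> Dm mx hm; apply: xget_unique => // y [Dy yx hy].
by apply/le_anti; rewrite hm // hy.
Qed.

Lemma nxt_eq D x m : D m -> x < m -> (forall y, D y -> x < y -> m <= y) ->
  nxt D x = m.
Proof.
move=> Dm mx hm; apply: xget_unique => // y [Dy yx hy].
by apply/le_anti; rewrite hm // hy.
Qed.

Lemma prv_congr D D' x y :
  (forall z, D z /\ z <= x <-> D' z /\ z <= y) -> prv D x = prv D' y.
Proof.
move=> DD'; rewrite /prv (wzero_eq hW x y); congr xget.
apply/seteqP; split => m [Dm mx hm]; split.
- by have [] := (DD' m).1 (conj Dm mx).
- by have [] := (DD' m).1 (conj Dm mx).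
- by move=> z Dz zy; have [] := (DD' z).2 (conj Dz zy); exact: hm.
- by have [] := (DD' m).2 (conj Dm mx).
- by have [] := (DD' m).2 (conj Dm mx).
- by move=> z Dz zy; have [] := (DD' z).1 (conj Dz zy); exact: hm.
Qed.

Lemma ex_nxt D x c : D c -> x < c -> exists m,
  [/\ D m, x < m, m <= c & forall y, D y -> x < y -> m <= y].
Proof.
move=> Dc xc; have [|m [Dm xm] hm] := @ex_least _ _ hW [set y | D y /\ x < y].
  by exists c.
by exists m; split => // [|y Dy xy]; apply: hm.
Qed.

(** The least upper bound of the points of [D] up to [x] is in [D]: otherwise it would be a limit of
    such points, and [D] is closed. *)
Lemma ex_prv D x c : club D -> D c -> c <= x -> exists m,
  [/\ D m, c <= m, m <= x & forall y, D y -> y <= x -> y <= m].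
Proof.
move=> [cl _] Dc cx.
have [|m ub lub] := @ex_least _ _ hW [set b | forall y, D y -> y <= x -> y <= b].
  by exists x.
have mx : m <= x by apply: lub.
have cm : c <= m by apply: ub.
exists m; split => //; apply: contrapT => nDm.
have hm b : b < m -> exists2 y, D y & b < y < m.
  move=> bm; apply: contrapT => nex.
  suff : m <= b by rewrite leNgt bm.
  apply: lub => y Dy yx; rewrite leNgt; apply/negP => by_; apply: nex.
  exists y => //; rewrite by_ lt_neqAle ub // andbT.
  by apply/eqP => ym; rewrite -ym in nDm.
have lm : limit m.
  split; last by move=> b /hm[y _ /andP[]]; exists y.
  exists c; rewrite /below /= lt_neqAle cm andbT.
  by apply/eqP => ccm; rewrite ccm in Dc.
apply: nDm; apply: cl => //; split; first by move=> y [].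
move=> b /hm[y Dy /andP[by_ ym]]; exists y => //; exact: ltW.
Qed.

(** The sequence is consulted only at [prv D x <= x]. So the colour at [x] is a function of the
    predecessor of height [x], whose last position is [x]. *)
Lemma colour_agree h D a u v x : agree a u v -> x < a ->
  colour h D u x = colour h D v x.
Proof. by move=> uv xa; rewrite /colour uv // (le_lt_trans (prv_le _ _)). Qed.

Lemma coherent_agree h D a u v : agree a u v ->
  coherent h D a u -> coherent h D a v.
Proof.
move=> uv hu c ca Dc; apply: sub_finite_set (hu c ca Dc) => x [Cx hx].
split => //; rewrite (colour_agree _ _ uv) //.
exact: lt_le_trans (ladder_below hC (limit_of_limit Dc) Cx) ca.
Qed.

Lemma coherent_le h D a b u : b <= a -> coherent h D a u -> coherent h D b u.
Proof. by move=> ba hu c cb; apply: hu; exact: le_trans ba. Qed.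

Lemma coherent_wsucc h D a u : coherent h D a u -> coherent h D (wsucc a) u.
Proof.
move=> hu c; rewrite le_eqVlt => /orP[/eqP-> /limit_of_limit|].
  by move=> /(not_limit_wsucc hW).
by rewrite ltSw //; exact: hu.
Qed.

(** A point of [C a] not owned by [a] lies on a ladder ranked no later than [a] by [e b]. There are
    finitely many of these, and each meets [C a] in a finite set. *)
Lemma owner_finite h a b : limit a -> a <= b ->
  finite_set [set x | C a x /\ h (owner b x) <> h a].
Proof.
move=> la ab.
pose J := [set a' | [/\ limit a', a' <= b, a' <> a & (e b a' <= e b a)%N]].
have finJ : finite_set J.
  apply: (@finite_set_inj_bounded _ _ (e b) (e b a).+1).
    by move=> x y [_ xb _ _] [_ yb _ _]; exact: e_inj.
  by move=> x [].
apply: (@sub_finite_set _ _ (\bigcup_(a' in J) (C a `&` C a')%classic)).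
  move=> x [Cx hx].
  pose P := [set a | [/\ limit a, a <= b, C a x &
    forall a', limit a' -> a' <= b -> C a' x -> (e b a <= e b a')%N]].
  have [o Po] : P !=set0.
    have exn : exists n, `[< exists a', [/\ limit a', a' <= b, C a' x & e b a' = n] >].
      by exists (e b a); apply/asboolP; exists a.
    case: (ex_minnP exn) => n /asboolP[a' [la' a'b Ca' <-]] hn.
    exists a'; split => // a2 la2 a2b Ca2; apply: hn.
    by apply/asboolP; exists a2.
  have [lo ob Co ho] : P (owner b x) by exact: (@xgetI _ x P o).
  exists (owner b x) => //; split => //; last exact: ho.
  by move=> oa; apply: hx; rewrite oa.
apply: bigcup_finite => // a' [la' _ a'a _].
by apply: (ladder_almost_disjoint hC) => // /esym.
Qed.

(** If [a] is not a limit point of [D], then [prv D] and [nxt D] are constant on the ladder above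
    some [b < a]. The exceptions are points up to [b], overridden points, and points with an owner
    of another value, each finite in number. *)
Lemma coherent_uniformizes h D a u : club D -> limit a -> coherent h D a u ->
  finite_set [set x | C a x /\ colour h D u x <> h a].
Proof.
move=> cD la hu; have [Da|nDa] := pselect (limit_of D a); first exact: hu.
have [b ba hb] := not_limit_of la nDa.
have [c' Dc' bc'] := cD.2 b.
have [m [Dm bm _ hm]] := ex_nxt Dc' bc'.
have am : a <= m by exact: hb.
set p := twoadic_code (u (prv D b)).
apply: (@sub_finite_set _ _ (setU (setU [set x | C a x /\ x < wsucc b]
  [set x | x <= m /\ (e m x < p.2)%N]) [set x | C a x /\ h (owner m x) <> h a])).
  move=> x [Cx hx]; have xa := ladder_below hC la Cx.
  have [xb|bx] := leP x b; first by left; left; split => //; rewrite ltSw.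
  have xnxt : nxt D x = m.
    apply: nxt_eq => // [|y Dy xy]; first exact: lt_le_trans am.
    by apply: hm => //; exact: lt_trans xy.
  have xprv : prv D x = prv D b.
    apply: prv_congr => z; split => -[Dz zx]; split => //.
      rewrite leNgt; apply/negP => /(hb _ Dz); rewrite leNgt.
      by rewrite (le_lt_trans zx).
    by apply: le_trans zx _; exact: ltW.
  move: hx; rewrite /colour xnxt xprv -/p; case: ifP => [ex _|_ ?]; last by right.
  by left; right; split => //; apply: ltW; exact: lt_le_trans am.
rewrite !finite_setU; split; [split|].
- by apply: (ladder_finite_below hC) => //; exact: limit_wsucc.
- apply: (@finite_set_inj_bounded _ _ (e m) p.2) => [x y [xm _] [ym _]|x [_ //]].
  exact: e_inj.
- exact: owner_finite.
Qed.

(** Since [a] is a limit point of [D], the next point of [D] after [x] is still below [a], and so is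
    the owner of [x]. *)
Lemma colour_local h h' D a u x : limit_of D a -> x < a ->
  (forall y, y < a -> h y = h' y) ->
  colour h D u x = colour h' (D `&` below a)%classic u x.
Proof.
move=> Da xa hh'; have [c [Dc xc ca]] := Da.2 x xa.
have [m [Dm xm mc hm]] := ex_nxt Dc xc.
have ma := le_lt_trans mc ca.
have n1 : nxt D x = m by exact: nxt_eq.
have n2 : nxt (D `&` below a)%classic x = m.
  by apply: nxt_eq => // y [Dy _]; exact: hm.
have pE : prv D x = prv (D `&` below a)%classic x.
  apply: prv_congr => z; split => [[Dz zx]|[[Dz _] zx]//].
  by do !split => //; exact: le_lt_trans xa.
rewrite /colour n1 n2 pE; case: ifP => // _; apply: hh'.
rewrite /owner; case: xgetP => [y _ [_ ym _ _]|//].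
exact: le_lt_trans ma.
Qed.

(** Agreement is required at [a] too, as coherence at [a] mentions [h a]; this is why [requirements]
    guesses one more natural number. *)
Lemma coherent_local h h' D a u : limit_of D a -> (forall y, y <= a -> h y = h' y) ->
  coherent h' (D `&` below a)%classic a u <-> coherent h D a u.
Proof.
move=> Da hh'.
have hlt y : y < a -> h y = h' y by move=> ya; apply: hh'; exact: ltW.
have limE c : c <= a -> (limit_of (D `&` below a)%classic c <-> limit_of D c).
  move=> ca; split => -[c0 hc]; split => // b /hc[y].
    by move=> [[Dy _] by_ yc]; exists y.
  move=> [Dy by_ yc]; exists y; split => //; split => //.
  exact: lt_le_trans ca.
have xlt c x : c <= a -> limit_of D c -> C c x -> x < a.
  move=> ca /limit_of_limit lc Cx; apply: lt_le_trans ca.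
  exact: (ladder_below hC lc).
split => hu c ca Dc.
  apply: sub_finite_set (hu c ca ((limE c ca).2 Dc)) => x [Cx hx]; split => //.
  by rewrite -(colour_local u Da (xlt _ _ ca Dc Cx) hlt) -hh'.
have Dc' := (limE c ca).1 Dc.
apply: sub_finite_set (hu c ca Dc') => x [Cx hx]; split => //.
by rewrite (colour_local u Da (xlt _ _ ca Dc' Cx) hlt) hh'.
Qed.

(** * Extending nodes, and coherent nodes, to all higher levels *)

Section Extension.
Context (Qf : W -> set (set (W -> rat))).
Context (Qf_setT : forall a, Qf a [set: W -> rat]).
Let lv := lev hW Qf.

(** Every code occurs between [r'] and [r], by density. *)
Lemma ext_wsucc a v r r' p : lv a v -> r' < r -> (forall x, x < a -> v x <= r') ->
  exists q, [/\ twoadic_code q = p, lv (wsucc a) (set_at v a q) &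
    bounded_below (wsucc a) (set_at v a q) r].
Proof.
move=> av r'r vr'; have [q /andP[r'q qr] qp] := twoadic_code_dense p r'r.
exists q; split => //.
  by apply: lev_wsucc => // x /vr' /le_lt_trans; exact.
exists q => // x; rewrite ltSw // le_eqVlt => /orP[/eqP->|xa].
  by rewrite /set_at eqxx.
by rewrite -set_at_agree //; apply: le_trans (vr' x xa) (ltW _).
Qed.

(** At a limit, climbing along its ladder below an intermediate bound [r1 < r] gives a branch; the
    trivial requirement with bound [r1] then puts one into the level. *)
Lemma ext_lev a b u r : b <= a -> lv b u -> bounded_below b u r ->
  exists v, [/\ lv a v, agree b u v & bounded_below a v r].
Proof.
elim/(omega1_ind hW): a b u r => a IH b u r.
rewrite le_eqVlt => /orP[/eqP->|ba] bu ur; first by exists u.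
have [a0|[c ac]|la] := omega1_cases hW a; first by have := a0 b.
  have ca : c < a by rewrite ac ltwS.
  have bc : b <= c by rewrite -ltSw // -ac.
  have [v [cv uv [r' r'r vr']]] := IH c ca b u r bc bu ur.
  have [q [_ h1 h2]] := ext_wsucc (0, 0)%N cv r'r vr'.
  exists (set_at v c q); rewrite ac; split => //.
  exact: agree_trans bc uv (@set_at_agree _ _ v c q).
have [g [gmono ginj gsurj]] := ladder_index hC la.
have [r1 r1r ur1] := bounded_between ur.
pose Inv i c w := [/\ lv c w, c < a, bounded_below c w r1 &
  forall y, C a y -> (g y < i)%N -> y < c].
have [||||v [bv uv vr _]] := @branch_of_steps _ _ hW Qf a b u r1 Inv.
- by split.
- move=> i c w [cw _ [r2 r2r hr2] _]; split => // x /hr2 /le_trans; apply.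
  exact: ltW.
- move=> i c w [cw ca wr hc]; have [y Cy gy] := gsurj i.
  have zy z : C a z -> (g z < i.+1)%N -> z <= y.
    by move=> Cz; rewrite ltnS -gy leNgt gmono // -leqNgt.
  have [yc|cy] := ltP y c.
    exists c, w; split => //; split => // z Cz /zy zy'.
    exact: le_lt_trans (zy' Cz) yc.
  have Sya : wsucc y < a by apply: limit_wsucc => //; exact: (ladder_below hC).
  have cSy : c <= wsucc y by apply: le_trans cy (ltW (ltwS hW y)).
  have [w' [h1 h2 h3]] := IH _ Sya c w r1 cSy cw wr.
  exists (wsucc y), w'; split => //; split => // z Cz /zy zy'.
  by rewrite ltSw // zy'.
- move=> x xa; have [[_ /(_ x xa)[y Cy xy]] _] := hC la.
  exists (g y).+1 => c w [_ _ _ hc]; apply: le_lt_trans xy _.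
  exact: hc.
rewrite min_r ?(ltW ba) // in uv.
have [|v' [av' [_ uv' v'r _]]] := @lev_limit _ _ hW Qf a b u r1 setT la ba bu (Qf_setT a).
  by exists v.
by exists v'; split => //; exists r1.
Qed.

Context (h : W -> nat) (D : set W).
Context (clubD : club D).
Context (guessed : forall a, limit_of D a ->
  exists2 Q, Qf a Q & forall u, Q u <-> coherent h D a u).

(** The only hard case is a limit point [a] of [D], where one climbs through points of [D] and
    forces the colour [h a] on the ladder interval by interval. *)
Lemma ext_coherent a b u r : b <= a -> lv b u -> coherent h D b u ->
  bounded_below b u r ->
  exists v, [/\ lv a v, agree b u v, coherent h D a v & bounded_below a v r].
Proof.
elim/(omega1_ind hW): a b u r => a IH b u r.
rewrite le_eqVlt => /orP[/eqP->|ba] bu hu ur; first by exists u.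
have [a0|[c ac]|la] := omega1_cases hW a; first by have := a0 b.
  have ca : c < a by rewrite ac ltwS.
  have bc : b <= c by rewrite -ltSw // -ac.
  have [v [cv uv hv [r' r'r vr']]] := IH c ca b u r bc bu hu ur.
  have [q [_ h1 h2]] := ext_wsucc (0, 0)%N cv r'r vr'.
  exists (set_at v c q); rewrite ac; split => //.
    exact: agree_trans bc uv (@set_at_agree _ _ v c q).
  by apply: coherent_wsucc; apply: coherent_agree hv; exact: set_at_agree.
have [Da|nDa] := pselect (limit_of D a); last first.
  (* No limit point of [D] lies above [c] and up to [a], so beyond [c] any extension remains
     coherent. *)
  have [c ca hc] := not_limit_of la nDa.
  have ma : Order.max b c < a by rewrite gt_max ba ca.
  have bm : b <= Order.max b c by rewrite le_max lexx.
  have cm : c <= Order.max b c by rewrite le_max lexx orbT.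
  have [v1 [mv1 uv1 hv1 v1r]] := IH _ ma b u r bm bu hu ur.
  have [v [av v1v vr]] := ext_lev (ltW ma) mv1 v1r.
  exists v; split => //; first exact: agree_trans uv1 v1v.
  move=> y ya Dy; have [ym|my] := leP y (Order.max b c).
    exact: (coherent_agree v1v hv1).
  have [z [Dz mz zy]] := Dy.2 _ my.
  have := hc z Dz (le_lt_trans cm mz); rewrite leNgt.
  by rewrite (lt_le_trans zy ya).
have [g [gmono ginj gsurj]] := ladder_index hC la.
have [r1 r1r ur1] := bounded_between ur.
(* The climb starts at a point of [D], giving up the finitely many ladder points below it. *)
have [c0 [Dc0 bc0 c0a]] := Da.2 b ba.
have [u0 [c0u0 uu0 hu0 u0r]] := IH c0 c0a b u r1 (ltW bc0) bu hu ur1.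
pose Inv i c w := [/\ [/\ lv c w, coherent h D c w & bounded_below c w r1],
  [/\ D c, c0 <= c & c < a],
  forall x, C a x -> c0 <= x -> x < c -> colour h D w x = h a &
  forall y, C a y -> (g y < i)%N -> y < c].
have [||||v [bv uv vr vInv]] := @branch_of_steps _ _ hW Qf a c0 u0 r1 Inv.
- by split => // x _ c0x; rewrite ltNge c0x.
- move=> i c w [[cw _ [r2 r2r hr2]] _ _ _]; split => // x /hr2 /le_trans; apply.
  exact: ltW.
- move=> i c w [[cw hw wr] [Dc c0c ca] wcol hc]; have [y Cy gy] := gsurj i.
  have zy z : C a z -> (g z < i.+1)%N -> z <= y.
    by move=> Cz; rewrite ltnS -gy leNgt gmono // -leqNgt.
  have [yc|cy] := ltP y c.
    exists c, w; split => //; split => // z Cz /zy zy'.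
    exact: le_lt_trans (zy' Cz) yc.
  have ya := ladder_below hC la Cy.
  (* The next ladder point [y] lies between the successive points [m] and [n] of [D]. *)
  have [m [Dm cm my mmax]] := ex_prv clubD Dc cy.
  have [w1 [mw1 ww1 hw1 [r2 r2r w1r]]] :=
    IH m (le_lt_trans my ya) c w r1 cm cw hw wr.
  have [c' [Dc' yc' c'a]] := Da.2 y ya.
  have [n [Dn yn nc' nmin]] := ex_nxt Dc' yc'.
  have na := le_lt_trans nc' c'a.
  have mn := le_lt_trans my yn.
  (* [k] exceeds the rank under [e n] of every ladder point below [n], so the code [(h a, k)] at
     position [m] gives those from [m] on the colour [h a]. *)
  have [k hk] := finite_set_bounded (e n) (ladder_finite_below hC la na).
  have [q [qcode mw2 w2r]] := ext_wsucc (h a, k) mw1 r2r w1r.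
  have w1w2 := @set_at_agree _ _ w1 m q.
  have hw2 : coherent h D (wsucc m) (set_at w1 m q).
    by apply: coherent_wsucc; apply: coherent_agree hw1.
  have Smn : wsucc m <= n by rewrite leSw.
  have [w3 [nw3 w2w3 hw3 w3r]] := IH n na _ _ r1 Smn mw2 hw2 w2r.
  have ww3 : agree c w w3.
    apply: agree_trans (w2w3); first exact: le_trans cm (ltW (ltwS hW m)).
    exact: agree_trans cm ww1 w1w2.
  exists n, w3; split => //; first exact: le_trans cm (ltW mn).
  split => //.
  + by split => //; apply: le_trans c0c _; exact: le_trans cm (ltW mn).
  + move=> x Cx c0x xn; have [xc|cx] := ltP x c.
      by rewrite -(colour_agree _ _ ww3) // wcol.
    (* A ladder point below [m] precedes [y], hence was already passed and lies below [c]. *)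
    have mx : m <= x.
      rewrite leNgt; apply/negP => xm; move: cx; rewrite leNgt hc //.
      by rewrite -gy -gmono //; exact: lt_le_trans xm my.
    have xprv : prv D x = m.
      apply: prv_eq => // z Dz zx; apply: mmax => //.
      rewrite leNgt; apply/negP => /(nmin _ Dz).
      by rewrite leNgt (le_lt_trans zx xn).
    have xnxt : nxt D x = n.
      apply: nxt_eq => // z Dz xz; apply: nmin => //.
      rewrite ltNge; apply/negP => /(mmax _ Dz).
      by rewrite leNgt (le_lt_trans mx xz).
    have w3m : w3 m = q by rewrite -w2w3 ?ltwS // /set_at eqxx.
    by rewrite /colour xprv xnxt w3m qcode /= hk.
  + by move=> z Cz /zy zy'; apply: le_lt_trans (zy' Cz) yn.
- move=> x xa; have [[_ /(_ x xa)[y Cy xy]] _] := hC la.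
  exists (g y).+1 => c w [_ _ _ hc]; apply: le_lt_trans xy _.
  exact: hc.
rewrite min_r ?(ltW c0a) // in uv.
have hv : coherent h D a v.
  move=> c; rewrite le_eqVlt => /orP[/eqP-> _|ca Dc]; last first.
    have [i [c1 [w [[[_ hw _] _ _ _] cc1 wv]]]] := vInv c ca.
    have /coherent_agree : agree c w v.
      by apply: agree_le wv; rewrite le_min !ltW.
    by move=> /(_ h D (coherent_le (ltW cc1) hw)); apply.
  (* At [a] itself every exception lies below [c0]. *)
  apply: sub_finite_set (ladder_finite_below hC la c0a) => x [Cx hx].
  split => //; rewrite ltNge; apply/negP => c0x; apply: hx.
  have xa := ladder_below hC la Cx.
  have [i [c1 [w [[_ _ wcol _] xc1 wv]]]] := vInv x xa.
  rewrite -(colour_agree h D wv) ?wcol //.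
  by rewrite lt_min xa xc1.
(* [v] itself may be missing from the level; it shows that the guessed requirement is satisfiable,
   so a coherent branch was selected. *)
have [Q QQ QE] := guessed Da.
have [|v' [av' [_ uv' v'r /QE Qv']]] := @lev_limit _ _ hW Qf a b u r1 Q la ba bu QQ.
  by exists v; split => //; [exact: agree_trans (ltW bc0) uu0 uv | exact/QE].
by exists v'; split => //; exists r1.
Qed.

End Extension.
End Colouring.

(** * Uniqueness of heights *)

Section OrderIso.
Context (d : Order.disp_t) (W : orderType d) (hW : is_omega1 W).
Context (N : choiceType) (le : N -> N -> Prop).
Implicit Types (a b x y : W) (P : set N).

Lemma order_iso_image (k : W -> N) a P :
  P = k @` below a ->
  (forall x y, x < a -> y < a -> (le (k x) (k y) <-> x <= y)) ->
  order_iso le P (fun x y : W => x <= y) (below a).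
Proof.
move=> PE kmono.
pose g t := xget a [set x | x < a /\ k x = t].
have gP t : P t -> g t < a /\ k (g t) = t.
  rewrite PE => -[x xa xt].
  exact: (@xgetI _ a [set x | x < a /\ k x = t] x).
have kinj x y : x < a -> y < a -> k x = k y -> x = y.
  move=> xa ya kxy; have kxx := (kmono x x xa xa).2 (lexx x).
  apply/le_anti/andP; split; apply/kmono => //; first by rewrite -kxy.
  by rewrite kxy in kxx *.
have gk x : x < a -> g (k x) = x.
  move=> xa; have [|ga kg] := gP (k x); first by rewrite PE; exists x.
  exact: kinj.
exists g; split; first split.
- by move=> t /gP[].
- by move=> s t; rewrite !inE => /gP[_ sE] /gP[_ tE] gst; rewrite -sE -tE gst.
- by move=> x xa; exists (k x); [rewrite PE; exists x | exact: gk].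
- by move=> s t /gP[gs sE] /gP[gt tE]; rewrite -{1}sE -{1}tE; exact: kmono.
Qed.

(** By induction on the value the two isomorphisms coincide, so neither range can be longer. *)
Lemma order_iso_below_unique P a b :
  order_iso le P (fun x y : W => x <= y) (below a) ->
  order_iso le P (fun x y : W => x <= y) (below b) -> a = b.
Proof.
move=> [g1 [[m1 i1 s1] h1]] [g2 [[m2 i2 s2] h2]].
have key x : forall p, P p -> g1 p = x -> g2 p = x.
  elim/(omega1_ind hW): x => x IH p Pp px.
  have [x2|x2|//] := ltgtP (g2 p) x.
    have xb : g2 p < a by apply: lt_trans x2 _; rewrite -px; exact: m1.
    have [p' Pp' p'E] := s1 _ xb.
    have := IH _ x2 p' Pp' p'E => /i2 pp'.
    by move: x2; rewrite -px -pp' ?inE // p'E pp' ?inE // ltxx.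
  have xb : x < b by apply: lt_trans x2 _; exact: m2.
  have [p' Pp' p'E] := s2 _ xb.
  have := h2 p' p Pp' Pp; rewrite p'E => /iffRL /(_ (ltW x2)) /(h1 _ _ Pp' Pp).
  rewrite px le_eqVlt => /orP[/eqP p'x|p'x].
    have p'p : p' = p by apply: i1; rewrite ?inE // px.
    by rewrite -p'p.
  by have := IH _ p'x p' Pp' erefl; rewrite p'E => xp'; rewrite xp' ltxx in p'x.
apply/eqP/negPn/negP; rewrite neq_lt => /orP[ab|ba].
  have [p Pp pa] := s2 _ ab; have := m1 _ Pp.
  by rewrite /below /= -(key _ p Pp erefl) pa ltxx.
by have [p Pp pa] := s1 _ ba; have := m2 _ Pp; rewrite /below /= (key _ p Pp pa) ltxx.
Qed.

Lemma order_iso_least P a :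
  order_iso le P (fun x y : W => x <= y) (below a) -> least_elements le P.
Proof.
move=> [g [_ gmono]] B BP [t Bt].
have [|_ [m Bm <-] hm] := @ex_least _ _ hW (g @` B); first by exists (g t), t.
by exists m => // s Bs; apply/gmono; [exact: BP|exact: BP|apply: hm; exists s].
Qed.

End OrderIso.

(** * From increasing sequences to a tree of sets of rationals *)

Section Segments.
Context (d : Order.disp_t) (W : orderType d) (hW : is_omega1 W).
Implicit Types (a b c x y : W) (u v : W -> rat) (A : set rat).

Definition seg u a : set rat := u @` below a.

Definition incr a u := forall x y, x < y -> y < a -> u x < u y.

Lemma incr_le a u x y : incr a u -> x < a -> y < a -> (u x <= u y) = (x <= y).
Proof.
move=> iu xa ya; case: (ltgtP x y) => [xy|yx|->]; last by rewrite lexx.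
  by rewrite ltW // iu.
by apply/negbTE; rewrite -ltNge iu.
Qed.

Lemma incr_inj a u x y : incr a u -> x < a -> y < a -> u x = u y -> x = y.
Proof. by move=> iu xa ya uxy; apply/le_anti; rewrite -!(incr_le iu) // uxy lexx. Qed.

Lemma eq_seg a u v : agree a u v -> seg u a = seg v a.
Proof.
move=> uv; apply/seteqP; split => _ [x xa <-]; exists x => //; last exact: uv.
by rewrite uv.
Qed.

(** Once the earlier values are matched, [u x] can only reappear in [v] at [x] or later, and
    symmetrically, so the two values at [x] bound each other. *)
Lemma seg_inj a b u v : incr a u -> incr b v -> seg u a = seg v b ->
  a = b /\ agree a u v.
Proof.
move=> iu iv E.
have key x : x < a -> x < b -> u x = v x.
  elim/(omega1_ind hW): x => x IH xa xb.
  have [y yb yE] : seg v b (u x) by rewrite -E; exists x.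
  have [z za zE] : seg u a (v x) by rewrite E; exists x.
  have xy : x <= y.
    rewrite leNgt; apply/negP => yx.
    have ya := lt_trans yx xa.
    have := IH y yx ya yb; rewrite yE => /(incr_inj iu ya xa) yx'.
    by rewrite yx' ltxx in yx.
  have xz : x <= z.
    rewrite leNgt; apply/negP => zx.
    have zb := lt_trans zx xb.
    have := IH z zx za zb; rewrite zE => /(incr_inj iv xb zb) zx'.
    by rewrite zx' ltxx in zx.
  apply/le_anti/andP; split; first by rewrite -zE (incr_le iu).
  by rewrite -yE (incr_le iv).
suff ab : a = b by split => // x xa; apply: key => //; rewrite -ab.
apply/eqP/negPn/negP; rewrite neq_lt => /orP[ab|ba].
  have [y ya yE] : seg u a (v a) by rewrite E; exists a.
  have yb := lt_trans ya ab; move: yE; rewrite key // => /(incr_inj iv yb ab) ya'.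
  by rewrite /below /= ya' ltxx in ya.
have [y yb yE] : seg v b (u b) by rewrite -E; exists b.
have ya := lt_trans yb ba; move: yE; rewrite -key // => /(incr_inj iu ya ba) yb'.
by rewrite /below /= yb' ltxx in yb.
Qed.

Lemma seg_end_extends b c v : incr b v -> c <= b -> end_extends (seg v c) (seg v b).
Proof.
move=> iv cb; split.
  by move=> _ [x xc <-]; exists x => //; exact: lt_le_trans cb.
move=> _ _ [x xc <-] [[y yb <-] ny]; apply: iv => //; apply: lt_le_trans xc _.
by rewrite leNgt; apply/negP => yc; apply: ny; exists y.
Qed.

Lemma end_extends_seg b v A : incr b v -> end_extends A (seg v b) ->
  exists2 c, c <= b & A = seg v c.
Proof.
move=> iv [Ab hA].
(* [c] is the first position whose value is outside [A], or [b] if there is none. *)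
have [|c hc cmin] := @ex_least _ _ hW [set x | b <= x \/ ~ A (v x)].
  by exists b; left.
have cb : c <= b by apply: cmin; left.
exists c => //; apply/seteqP; split.
  move=> q Aq; have [x xb xE] := Ab _ Aq; exists x => //.
  rewrite /below /= ltNge; apply/negP => cx.
  have cb' := le_lt_trans cx xb.
  have nAc : ~ A (v c) by case: hc => //; rewrite leNgt cb'.
  have : q < v c by apply: hA => //; split => //; exists c.
  by rewrite -xE ltNge (incr_le iv) // cx.
move=> _ [x xc <-]; apply: contrapT => nA.
by have := cmin x (or_intror nA); rewrite leNgt xc.
Qed.

Lemma seg_end_extends_iff b v x y : incr b v -> x <= b -> y <= b ->
  (end_extends (seg v x) (seg v y) <-> x <= y).
Proof.
move=> iv xb yb.
have iv' z : z <= b -> incr z v.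
  by move=> zb p q pq qz; apply: iv => //; exact: lt_le_trans zb.
split => [/(end_extends_seg (iv' _ yb))[c cy E]|xy]; last first.
  exact: seg_end_extends (iv' _ yb) xy.
by have [->] := seg_inj (iv' _ xb) (iv' _ (le_trans cy yb)) E.
Qed.

Lemma end_extends_trans A1 A2 A3 :
  end_extends A1 A2 -> end_extends A2 A3 -> end_extends A1 A3.
Proof.
move=> [s12 h12] [s23 h23]; split; first exact: subset_trans s23.
move=> x y A1x [A3y nA1y]; have [A2y|nA2y] := pselect (A2 y); first exact: h12.
by apply: h23 => //; exact: s12.
Qed.

Context (Qf : W -> set (set (W -> rat))).
Let lv := lev hW Qf.

(** Only successor lengths occur because nodes of [sigmaQ'] have a maximum; a node of limit height
    adds one point to a branch of limit length. *)
Definition tree_of (P : W -> (W -> rat) -> Prop) : set (set rat) :=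
  [set t | exists a u, [/\ lv (wsucc a) u, P (wsucc a) u & t = seg u (wsucc a)]].

Let T := tree_of (fun _ _ => True).

Lemma lev_incr_on a u : lv a u -> incr a u.
Proof. by move=> au x y; exact: (lev_incr au). Qed.

Lemma tree_ofT a u : lv (wsucc a) u -> T (seg u (wsucc a)).
Proof. by move=> au; exists a, u. Qed.

Lemma sigmaQ'_seg a u : lv (wsucc a) u -> sigmaQ' (seg u (wsucc a)).
Proof.
move=> au; have iu := lev_incr_on au; have aS := ltwS hW a.
have ub q : seg u (wsucc a) q -> q <= u a.
  by move=> [x xa <-]; rewrite (incr_le iu) // -ltSw.
split; last by exists (u a) => //; exists a.
split; last by exists (u a).
move=> B Bs [q Bq].
have [|m [ma Bm] hm] := @ex_least _ _ hW [set x | x < wsucc a /\ B (u x)].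
  by have [x xa xq] := Bs _ Bq; exists x; rewrite /= xq.
exists (u m) => // q' Bq'; have [x xa xq'] := Bs _ Bq'.
by rewrite -xq' (incr_le iu) //; apply: hm; rewrite /= xq'.
Qed.

Lemma sub_sigmaQ' : T `<=` sigmaQ'.
Proof. by move=> _ [a [u [au _ ->]]]; exact: sigmaQ'_seg. Qed.

(** A predecessor with a maximum is cut off right after that maximum, hence at a successor. *)
Lemma sigmaQ'_below_seg a u t : lv (wsucc a) u -> sigmaQ' t ->
  end_extends t (seg u (wsucc a)) -> exists2 x, x <= a & t = seg u (wsucc x).
Proof.
move=> au [_ [q tq qmax]] /(end_extends_seg (lev_incr_on au))[c ca tE].
have iu := lev_incr_on au.
move: (tq); rewrite {1}tE => -[x xc xq]; exists x.
  by rewrite -ltSw //; exact: lt_le_trans ca.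
rewrite tE; congr seg; apply/le_anti/andP; split; last by rewrite leSw.
rewrite leNgt; apply/negP => Sxc.
have : u (wsucc x) <= q by apply: qmax; rewrite tE; exists (wsucc x).
rewrite -xq leNgt iu ?ltwS //; exact: lt_le_trans ca.
Qed.

Lemma seg_wsucc_trunc a u x : x <= a -> lv (wsucc a) u ->
  lv (wsucc x) (trunc u (wsucc x)) /\
  seg u (wsucc x) = seg (trunc u (wsucc x)) (wsucc x).
Proof.
move=> xa au; split; first by apply: lev_trunc au _; rewrite leSS.
exact: eq_seg (@trunc_agree _ _ u (wsucc x)).
Qed.

(** All predecessors in [sigmaQ'] of a node of [T] are already in [T], so its height is the same in
    every [U] in between. *)
Lemma seg_height U a u : T `<=` U -> U `<=` sigmaQ' -> lv (wsucc a) u ->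
  has_height end_extends U (seg u (wsucc a)) a.
Proof.
move=> TU US au; have iu := lev_incr_on au.
apply: (@order_iso_image _ _ _ _ (fun x => seg u (wsucc x))); last first.
  move=> x y xa ya; rewrite -(leSS hW).
  by apply: seg_end_extends_iff iu _ _; rewrite leSS // ltW.
apply/seteqP; split.
  move=> t [Ut ts tns]; have [x xa tE] := sigmaQ'_below_seg au (US _ Ut) ts.
  exists x => //; rewrite /below /= lt_neqAle xa andbT.
  by apply/eqP => xa'; apply: tns; rewrite tE xa'.
move=> _ [x xa <-]; have [xl xE] := seg_wsucc_trunc (ltW xa) au; split.
- by apply: TU; rewrite xE; exact: tree_ofT.
- by apply: seg_end_extends => //; rewrite leSS // ltW.
- have ix : incr (wsucc x) u.
    move=> p q pq qx; apply: iu => //; apply: lt_le_trans qx _.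
    by rewrite leSS // ltW.
  move=> /(seg_inj ix iu)[/(wsucc_inj hW) xa' _].
  by rewrite /below /= xa' ltxx in xa.
Qed.

Lemma seg_height_unique a b u : lv (wsucc a) u ->
  has_height end_extends T (seg u (wsucc a)) b -> b = a.
Proof.
move=> au hb; apply: (order_iso_below_unique hW hb).
exact: seg_height sub_sigmaQ' au.
Qed.

Lemma restrict_seg a u x : lv (wsucc a) u -> x <= a ->
  Defs.restrict end_extends T (seg u (wsucc a)) x = seg u (wsucc x).
Proof.
move=> au xa; have [xl xE] := seg_wsucc_trunc xa au.
apply: xget_unique.
  split; [by rewrite xE; exact: tree_ofT| |].
    by apply: seg_end_extends (lev_incr_on au) _; rewrite leSS.
  by rewrite xE; exact: seg_height sub_sigmaQ' xl.
move=> t [Tt ts hx].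
have [y ya tE] := sigmaQ'_below_seg au (sub_sigmaQ' Tt) ts.
have [yl yE] := seg_wsucc_trunc ya au.
rewrite tE; move: hx; rewrite tE yE => /(seg_height_unique yl) ->.
by rewrite yE.
Qed.

(** Serves both for [T] inside [sigmaQ'], with trivial [P], and for the coherent nodes inside
    [T]. *)
Lemma tree_of_subtree U (P : W -> (W -> rat) -> Prop) :
  T `<=` U -> U `<=` sigmaQ' ->
  (forall a b u v, b <= a -> agree b u v -> P a u -> P b v) ->
  (forall a b u, b <= a -> lv b u -> P b u ->
     exists v, [/\ lv a v, agree b u v & P a v]) ->
  (exists a u, lv (wsucc a) u /\ P (wsucc a) u) ->
  subtree W end_extends U (tree_of P).
Proof.
move=> TU US Pdown Pext [a0 [u0 [au0 Pu0]]]; split.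
- by move=> _ [a [u [au _ ->]]]; apply: TU; exact: tree_ofT.
- by exists (seg u0 (wsucc a0)), a0, u0.
- move=> _ t [a [u [au Pu ->]]] Ut ts.
  have [x xa ->] := sigmaQ'_below_seg au (US _ Ut) ts.
  have [xl xE] := seg_wsucc_trunc xa au.
  exists x, (trunc u (wsucc x)); split => //; apply: Pdown Pu; first by rewrite leSS.
  exact: trunc_agree.
- move=> _ b [a [u [au Pu ->]]].
  have ab : wsucc a <= wsucc (Order.max a b) by rewrite leSS // le_max lexx.
  have [v [bv uv Pv]] := Pext _ _ _ ab au Pu.
  exists (seg v (wsucc (Order.max a b))), (Order.max a b); split.
  + by exists (Order.max a b), v.
  + by rewrite (eq_seg uv); apply: seg_end_extends ab; exact: lev_incr_on.
  + exact: seg_height.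
  + by rewrite le_max lexx orbT.
Qed.

Lemma tree_of_special : special end_extends T.
Proof.
exists (fun n => [set t | T t /\
  exists q, [/\ t q, forall p, t p -> p <= q & pickle q = n]]).
split; last first.
  apply/seteqP; split => [t Tt|t [n _ []//]].
  have [_ [q tq qmax]] := sub_sigmaQ' Tt.
  by exists (pickle q) => //; split => //; exists q.
move=> n; split; first by move=> t [].
move=> s t [Ts [q [sq qs qn]]] [Tt [q' [tq' q't q'n]]] [st hst].
have qq' : q = q' by apply: (pcan_inj pickleK); rewrite qn.
apply/seteqP; split => // x tx; apply: contrapT => nsx.
have := hst q x sq (conj tx nsx); rewrite ltNge qq'.
by rewrite q't.
Qed.

(** A chain meets each antichain in at most one point. *)
Lemma special_chain_countable (A : set (set rat)) (U : set (set rat)) :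
  special end_extends U -> chain end_extends U A -> countable A.
Proof.
move=> [F [Fanti UE]] [AU Achain].
have -> : A = \bigcup_n (F n `&` A)%classic.
  apply/seteqP; split => [t At|t [n _ []//]].
  by have := AU _ At; rewrite UE => -[n _ Fn]; exists n.
apply: bigcup_countable => [|n _]; first exact: countableP.
have [[t [Ft At]]|h] := pselect ((F n `&` A)%classic !=set0); last first.
  by apply: countable_subset (countable0 _) => t ht; apply: h; exists t.
apply: countable_subset (countable1 t) => s [Fs As] /=.
by have [/(Fanti n).2->|/(Fanti n).2->] := Achain _ _ As At.
Qed.

Lemma tree_of_aronszajn : (forall a, countable (Qf a)) ->
  (forall a, lv a !=set0) -> aronszajn W end_extends T.
Proof.
move=> cQ lev0; split.
- split.
  + by move=> s _; split => // x y sx [].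
  + by move=> s t _ _ [st _] [ts _]; exact/seteqP.
  + by move=> r s t _ _ _; exact: end_extends_trans.
  + move=> _ [a [u [au _ ->]]].
    exact: (order_iso_least hW (seg_height (@subset_refl _ T) sub_sigmaQ' au)).
- split.
    by move=> _ [a [u [au _ ->]]]; exists a; exact: seg_height sub_sigmaQ' au.
  move=> a; have [u au] := lev0 (wsucc a); exists (seg u (wsucc a)).
  by split; [exact: tree_ofT | exact: seg_height sub_sigmaQ' au].
- move=> a.
  apply: countable_subset
    (countable_image (seg^~ (wsucc a)) (countable_lev hW cQ (wsucc a))).
  move=> _ [[b [u [bu _ ->]]] /(seg_height_unique bu) ba].
  by exists u => //; rewrite ba.
- by move=> A; apply: special_chain_countable; exact: tree_of_special.
Qed.

End Segments.

(** * Requirements read off the diamond sequence *)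

Section Guessing.
Context (d : Order.disp_t) (W : orderType d) (hW : is_omega1 W).
Implicit Types (a x y : W) (X : set W) (h : W -> nat).

(* A function [h] on limits is coded by the set of the ordinals [a + h a], so
   that initial segments of limit length code the restrictions of [h]. *)
Definition encode h : set W :=
  [set x | exists2 a, limit a & x = iter (h a) (@wsucc _ W) a].

Definition decode X a : nat := xget 0%N [set n | X (iter n (@wsucc _ W) a)].

Definition update h a n : W -> nat := fun x => if x == a then n else h x.

Lemma decode_encode h a : limit a -> decode (encode h) a = h a.
Proof.
move=> la; apply: xget_unique; first by exists a.
have iter_inj n : injective (iter n (@wsucc _ W)).
  by elim: n => //= n IH x y /(wsucc_inj hW) /IH.
move=> n [b lb E]; have nb := limit_iter_inj hW la lb E.
by move: E; rewrite nb => /iter_inj ->.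
Qed.

Lemma decode_below X a x : limit a -> x < a ->
  decode (X `&` below a)%classic x = decode X x.
Proof.
move=> la xa; rewrite /decode; congr xget; apply/seteqP.
by split => [n []//|n Xn]; split => //; exact: limit_iter_wsucc.
Qed.

Context (C : W -> set W) (e : W -> W -> nat) (F : W -> set (set W)).

(** The two members of [F a] guess [h] and [D] below [a], the natural number guesses [h a], and the
    full set serves to extend arbitrary nodes. *)
Definition requirements a : set (set (W -> rat)) :=
  setU [set [set: W -> rat]]
    ((fun p => coherent C e (update (decode p.1.1) a p.2) p.1.2 a) @`
       (F a `*` F a `*` [set: nat])%classic).

Lemma countable_requirements a : countable (F a) -> countable (requirements a).
Proof.
move=> cF; apply: countable_setU; first exact: countable1.
by apply: countable_image; do !apply: countableX => //; exact: countableP.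
Qed.

End Guessing.

Theorem mainTheorem15 (d : Order.disp_t) (W : orderType d) (hW : is_omega1 W) :
  diamond_plus W ->
  forall C : W -> set W, ladder_system C ->
  exists T : set (set rat),
    [/\ subtree W end_extends sigmaQ' T,
        aronszajn W end_extends T,
        special end_extends T &
        forall f : W -> W -> nat, monochromatic C f ->
        exists (S : set (set rat)) (phi : set rat -> nat),
          uniformization end_extends C f T S phi].
Proof.
move=> [F [cF guess]] C hC.
have [e e_inj] := ex_segment_injections hW.
pose Qf := requirements C e F.
have QfT a : Qf a [set: W -> rat] by left.
have cQ a : countable (Qf a) by exact: countable_requirements.
have [z zmin] : exists z : W, forall x, ~ x < z.
  have [w _] : [set: W] !=set0.
    apply: contrapT => nW; case: hW => _ _; apply.
    by apply: countable_subset (countable0 W) => x _; apply: nW; exists x.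
  by exists (wzero w) => x; apply/negP; rewrite -leNgt; exact: wzero_le.
have zlev : lev hW Qf z (fun=> 0%R) by exact: lev_zero.
have zle a : z <= a by rewrite leNgt; apply/negP; exact: zmin.
have extT a b u : b <= a -> lev hW Qf b u -> True ->
    exists v, [/\ lev hW Qf a v, agree b u v & True].
  move=> ba bu _; have [r ur] := lev_bounded bu.
  by have [v [av uv _]] := ext_lev hC QfT ba bu ur; exists v.
have lev0 a : lev hW Qf a !=set0.
  by have [v [av _ _]] := extT a z _ (zle a) zlev I; exists v.
pose T := tree_of hW Qf (fun _ _ => True).
exists T; split.
- apply: tree_of_subtree => //; first exact: sub_sigmaQ'.
  by have [v av] := lev0 (wsucc z); exists z, v.
- exact: tree_of_aronszajn.
- exact: tree_of_special.
move=> f fmono.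
pose h0 a := f a (xget a (C a)).
(* Recoding makes [h] agree with the decoded guesses at non-limits as well, where [h0] is
   arbitrary. *)
pose h := decode (encode h0).
have hE a x : limit a -> C a x -> h a = f a x.
  move=> la Cx; rewrite /h decode_encode //; apply: fmono => //.
  exact: xgetI Cx.
have [D [clubD DF]] := guess (encode h0).
have guessed a : limit_of D a ->
    exists2 Q, Qf a Q & forall u, Q u <-> coherent C e h D a u.
  move=> Da; have la := limit_of_limit Da.
  have [FX FD] := DF a (limit_of_club clubD Da).
  exists (coherent C e (update (decode (encode h0 `&` below a)%classic) a (h a))
    (D `&` below a)%classic a).
    by right; exists ((encode h0 `&` below a)%classic, (D `&` below a)%classic, h a).
  move=> u; apply: coherent_local => // y ya.
  rewrite /update; case: eqP => [->//|/eqP nya].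
  by rewrite decode_below // lt_neqAle nya.
have extS a b u : b <= a -> lev hW Qf b u -> coherent C e h D b u ->
    exists v, [/\ lev hW Qf a v, agree b u v & coherent C e h D a v].
  move=> ba bu hu; have [r ur] := lev_bounded bu.
  have [v [av uv hv _]] := ext_coherent hC QfT clubD guessed ba bu hu ur.
  by exists v.
pose S := tree_of hW Qf (coherent C e h D).
(* A node gets the colour at its last position; by [seg_inj] and [colour_agree] this does not depend
   on the representing sequence. *)
pose phi (t : set rat) := xget 0%N [set n | exists a u,
  [/\ lev hW Qf (wsucc a) u, t = seg u (wsucc a) & n = colour C e h D u a]].
have phiE a u : lev hW Qf (wsucc a) u -> phi (seg u (wsucc a)) = colour C e h D u a.
  move=> au; apply: xget_unique; first by exists a, u.
  move=> _ [b [v [bv E ->]]].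
  have [/(wsucc_inj hW) ab uv] := seg_inj hW (lev_incr_on au) (lev_incr_on bv) E.
  by rewrite -ab -(colour_agree hW C e h D uv) // ltwS.
exists S, phi; split.
  apply: tree_of_subtree => //; first exact: sub_sigmaQ'.
  + move=> a b u v ba uv hu; apply: coherent_agree uv _ => //.
    exact: coherent_le hu.
  + have [|v [av _ hv]] := extS (wsucc z) z _ (zle _) zlev; last by exists z, v.
    move=> c cz [[x xc] _]; case: (zmin x); exact: lt_le_trans cz.
move=> _ a [b [u [bu hu ->]]] la /(seg_height_unique bu) ab; rewrite -{b}ab in bu hu *.
have ha : coherent C e h D a u by apply: coherent_le hu; exact/ltW/ltwS.
apply: sub_finite_set (coherent_uniformizes hW hC e_inj clubD la ha) => x [Cx].
have xa := ladder_below hC la Cx.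
have [xl xE] := seg_wsucc_trunc (ltW xa) bu.
rewrite (restrict_seg bu (ltW xa)) xE phiE // (hE a x) // => hx; split => //.
by rewrite (colour_agree hW C e h D (@trunc_agree _ _ u (wsucc x))) // ltwS.
Qed.
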